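(* Let $n \ge 1$, let $f:\mathbb{R}^n \to \mathbb{R}^N$ be a smooth map and let $a \in \mathbb{R}^n$. Suppose $f$ satisfies the local condition at $a$, i.e. every solution $(v_1,v_2,v_3,\lambda) \in \mathbb{R}^n\times\mathbb{R}^n\times\mathbb{R}^n\times\mathbb{R}$ of $$Df_a(v_1) + D^2f_a(v_2,v_3) + \lambda\, D^3f_a(v_3,v_3,v_3) = 0$$ with $v_3 \neq 0$ satisfies $v_1 = 0$, $v_2 = 0$ and $\lambda = 0$. Then there is an open neighborhood $U$ of $a$ such that $f|_U$ is a totally skew embedding, i.e. $f|_U$ is an embedding and $f(U)$ is totally skew at every pair of distinct points of $f(U)$.
   Context: For a smooth $f:\mathbb{R}^n\to\mathbb{R}^N$ and $a\in\mathbb{R}^n$, $D^kf_a$ denotes the symmetric $k$-linear map $(\mathbb{R}^n)^k\to\mathbb{R}^N$ of $k$-th order partial derivatives, defined on the standard basis by $D^kf_a(e_{i_1},\dots,e_{i_k}) = \frac{\partial^k f}{\partial x_{i_1}\cdots\partial x_{i_k}}(a)$; $D^1f_a = Df_a$ is the usual derivative. For a submanifold $M\subseteq\mathbb{R}^N$ and distinct points $p,q\in M$, $M$ is totally skew at $p$ and $q$ if for every (affine) line tangent to $M$ at $p$ and every line tangent to $M$ at $q$, the two lines are neither parallel nor intersecting. *)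

(* Defs.v *)
From HB Require Import structures.
From mathcomp Require Import all_boot all_order all_algebra.
From mathcomp Require Import all_classical all_reals all_analysis.
Set Implicit Arguments. Unset Strict Implicit. Unset Printing Implicit Defensive.
Import Order.TTheory GRing.Theory Num.Theory.
Import numFieldNormedType.Exports.
Local Open Scope classical_set_scope.
Local Open Scope ring_scope.

Section Defs.
Variables (R : realType) (n N : nat).
Implicit Types (f : 'rV[R]_n -> 'rV[R]_N) (a x : 'rV[R]_n).

Definition basis_vec (i : 'I_n) : 'rV[R]_n := delta_mx 0 i.

Definition iter_partial (s : seq 'I_n) f : 'rV[R]_n -> 'rV[R]_N :=
  foldr (fun i g => fun x => derive g x (basis_vec i)) f s.

Definition smooth f : Prop :=
  forall s : seq 'I_n,
    continuous (iter_partial s f) /\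
    forall (i : 'I_n) x, derivable (iter_partial s f) x (basis_vec i).

Definition D1 f a (v : 'rV[R]_n) : 'rV[R]_N :=
  \sum_(i < n) v 0 i *: iter_partial [:: i] f a.
Definition D2 f a (v w : 'rV[R]_n) : 'rV[R]_N :=
  \sum_(i < n) \sum_(j < n) (v 0 i * w 0 j) *: iter_partial [:: i; j] f a.
Definition D3 f a (u v w : 'rV[R]_n) : 'rV[R]_N :=
  \sum_(i < n) \sum_(j < n) \sum_(k < n)
     (u 0 i * v 0 j * w 0 k) *: iter_partial [:: i; j; k] f a.

Definition local_condition f a : Prop :=
  forall (v1 v2 v3 : 'rV[R]_n) (lam : R), v3 != 0 ->
    D1 f a v1 + D2 f a v2 v3 + lam *: D3 f a v3 v3 v3 = 0 ->
    [/\ v1 = 0, v2 = 0 & lam = 0].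

(* embedding of U: injective immersion which is a homeomorphism onto f(U)
   (continuity of f itself comes from smoothness) *)
Definition embedding_on f (U : set 'rV[R]_n) : Prop :=
  [/\ forall x y, U x -> U y -> f x = f y -> x = y,
      forall x, U x -> forall v, D1 f x v = 0 -> v = 0 &
      exists g : 'rV[R]_N -> 'rV[R]_n,
        (forall x, U x -> g (f x) = x) /\ {within f @` U, continuous g}].

Definition aff_line (p w : 'rV[R]_N) : set 'rV[R]_N :=
  [set p + t *: w | t in [set: R]].

(* two lines (given by point and nonzero direction) are parallel *)
Definition lines_parallel (p1 w1 p2 w2 : 'rV[R]_N) : Prop :=
  exists c : R, c != 0 /\ w1 = c *: w2.

Definition lines_intersect (p1 w1 p2 w2 : 'rV[R]_N) : Prop :=
  aff_line p1 w1 `&` aff_line p2 w2 !=set0.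

(* M = f(U); a tangent line to M at p = f x is p + R w with w a nonzero
   vector of the tangent space T_p M = image of Df_x *)
Definition tangent_dir f x (w : 'rV[R]_N) : Prop :=
  w != 0 /\ exists v : 'rV[R]_n, w = D1 f x v.

Definition totally_skew_at f x y : Prop :=
  forall w1 w2, tangent_dir f x w1 -> tangent_dir f y w2 ->
    ~ lines_parallel (f x) w1 (f y) w2 /\ ~ lines_intersect (f x) w1 (f y) w2.

Definition totally_skew_embedding f (U : set 'rV[R]_n) : Prop :=
  embedding_on f U /\
  forall x y, U x -> U y -> f x <> f y -> totally_skew_at f x y.

End Defs.

(* Main.v *)
Require Import Defs.
From HB Require Import structures.
From mathcomp Require Import all_boot all_order all_algebra.
From mathcomp Require Import all_classical all_reals all_analysis.
From mathcomp Require Import ring lra.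
Set Implicit Arguments. Unset Strict Implicit. Unset Printing Implicit Defensive.
Import Order.TTheory GRing.Theory Num.Theory.
Import numFieldNormedType.Exports.
Local Open Scope classical_set_scope.
Local Open Scope ring_scope.
(** For h = y - x, the trapezoid rule gives, in each component,
    f y - f x = (Df_x h + Df_y h) / 2 - D^3f(h, h, h) / 12 with D^3f taken at
    some point of the segment. Hence a relation Df_x u + Df_y v + mu (f y - f x) = 0,
    rewritten in terms of u' = u + mu h / 2 and v' = v + mu h / 2, becomes
    Df_x (u' + v') + D^2f(v', h) - mu / 12 D^3f(h, h, h) = 0.
    After rescaling h to a unit vector this is a small perturbation of the system
    in the local condition at a, which is bounded below by compactness; so
    u = v = 0 and mu = 0. The case mu = 0 excludes parallel tangents, mu = 1
    excludes intersecting ones, and the same lower bound with D^2f and D^3f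
    left out gives c |y - x| <= |f y - f x|, hence the embedding. *)

(** * Directional derivatives of real-valued functions on a normed space *)

Section DirectionalCalculus.
Variables (R : realType) (V : normedModType R).
Implicit Types (phi D : V -> R) (x y v w : V).

Lemma is_deriveP_cvg (W : normedModType R) (f : V -> W) x v l :
  is_derive x v f l <-> h^-1 *: (f (h *: v + x) - f x) @[h --> 0^'] --> l.
Proof.
split=> [[fd <-]|fl]; first exact: fd.
by split; [apply/cvg_ex; exists l | exact/cvg_lim].
Qed.

(** The two difference quotients coincide, since x + (h + t) v = h v + (x + t v). This brings
    one-variable theorems to bear on directional derivatives. *)
Lemma is_derive_line phi x v (t l : R) :
  is_derive t (1 : R) (fun s : R => phi (x + s *: v)) l <->
  is_derive (x + t *: v) v phi l.
Proof.
split=> [[D0 D1]|/is_deriveP_cvg H].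
  apply/is_deriveP_cvg; rewrite -D1; move: D0; rewrite /derivable /derive /=.
  have -> : (fun h : R => h^-1 *: (phi (x + (h *: 1 + t) *: v) - phi (x + t *: v)))
    = (fun h => h^-1 *: (phi (h *: v + (x + t *: v)) - phi (x + t *: v))).
    apply/funext => h; congr (_ *: (phi _ - _)).
    by rewrite scalerDl -scalerA scale1r addrCA.
  by [].
have E : (fun h : R => h^-1 *: (phi (x + (h *: 1 + t) *: v) - phi (x + t *: v)))
    = (fun h => h^-1 *: (phi (h *: v + (x + t *: v)) - phi (x + t *: v))).
  apply/funext => h; congr (_ *: (phi _ - _)).
  by rewrite scalerDl -scalerA scale1r addrCA.
split; first by rewrite /derivable /= E; apply/cvg_ex; exists l.
by rewrite /derive /= E; apply/cvg_lim.
Qed.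

(** Chain rule for s |-> c s at s = 0, which covers c = 0 as well. *)
Lemma is_derive_scale_dir phi x v (c l : R) :
  is_derive x v phi l -> is_derive x (c *: v) phi (c * l).
Proof.
move=> H; rewrite -[x](addr0 x) -(scale0r (c *: v)).
apply/is_derive_line.
have -> : (fun s : R => phi (x + s *: (c *: v)))
    = (fun s => phi (x + s *: v)) \o ( *%R^~ c).
  by apply/funext => s /=; rewrite scalerA.
rewrite mulrC; apply: is_derive1_comp.
  by apply/is_derive_line; rewrite mul0r scale0r addr0.
rewrite -[X in is_derive _ _ _ X]/(c : R) -[X in is_derive _ _ _ X]mulr1.
have -> : ( *%R^~ c : R -> R) = (c \*: (id : R -> R)).
  by apply/funext => s /=; rewrite mulrC.
exact: is_deriveZ.
Qed.

Lemma mean_value_dir phi D y v :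
  (forall z, is_derive z v phi (D z)) ->
  exists2 s : R, s \in `]0, 1[ & phi (y + v) - phi y = D (y + s *: v).
Proof.
move=> H.
have dH t : is_derive t (1 : R) (fun s : R => phi (y + s *: v)) (D (y + t *: v)).
  exact/is_derive_line.
have [|s s01] := @MVT R _ _ 0 1 ltr01 (fun t _ => dH t).
  by apply: derivable_within_continuous => t _; case: (dH t).
by rewrite scale1r scale0r addr0 subr0 mulr1; exists s.
Qed.

(** The step from partial derivatives to all directions: an increment along h (v + w) is one along h
    w followed by one along h v, and the mean value theorem writes the latter as h times [D] at a
    point tending to [x]. *)
Lemma is_derive_add_dir phi D x v w (l : R) :
  (forall y, is_derive y v phi (D y)) -> {for x, continuous D} ->
  is_derive x w phi l -> is_derive x (v + w) phi (D x + l).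
Proof.
move=> H cD /is_deriveP_cvg H2; apply/is_deriveP_cvg.
have -> : (fun h : R => h^-1 *: (phi (h *: (v + w) + x) - phi x)) =
  (fun h => h^-1 *: (phi ((h *: w + x) + h *: v) - phi (h *: w + x)) +
     h^-1 *: (phi (h *: w + x) - phi x)).
  apply/funext => h; rewrite -scalerDr addrA subrK; congr (_ *: (phi _ - _)).
  by rewrite scalerDr -addrA addrC.
apply: cvgD => //.
apply/cvgrPdist_lt => e e0.
move/cvgrPdist_lt : cD => /(_ e e0) /nbhs_ballP[d /= d0 dP].
have K0 : 0 < `|v| + `|w| + 1 by rewrite ltr_wpDl ?addr_ge0.
near=> h.
have hn0 : h != 0 by near: h; exact: nbhs_dnbhs_neq.
(* Along h v the derivative is h D, so the factor h cancels the h^-1 of the quotient. *)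
have [s s01 ->] := @mean_value_dir phi (fun z => h * D z) (h *: w + x) (h *: v)
   (fun z => is_derive_scale_dir h (H z)).
rewrite /GRing.scale /= mulKf //; apply: dP.
rewrite -ball_normE /=.
have -> : x - (h *: w + x + s *: (h *: v)) = - (h *: (w + s *: v)).
  rewrite [- (_ + _ + _)]opprD addrA [- (_ + x)]opprD addrCA subrr addr0.
  by rewrite scalerDr opprD !scalerA [s * h]mulrC.
rewrite normrN normrZ.
have hs : `|h| < d / (`|v| + `|w| + 1).
  near: h; apply: dnbhs0_lt; exact: divr_gt0.
apply: (@le_lt_trans _ _ (`|h| * (`|v| + `|w| + 1))); last by rewrite -ltr_pdivlMr.
rewrite ler_wpM2l // (le_trans (ler_normD _ _)) // normrZ.
move: s01; rewrite in_itv /= => /andP[s0 s1].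
rewrite (ger0_norm (ltW s0)) [`|v| + _]addrC -addrA lerD2l.
by rewrite (@le_trans _ _ (1 * `|v|)) ?ler_wpM2r ?(ltW s1) // mul1r lerDl.
Unshelve. all: by end_near. Qed.

End DirectionalCalculus.

(* The error functional G of the rule, corrected by K t^3 so as to vanish at both ends, is hit by Rolle twice. *)
Lemma trapezoid_rule (R : realType) (g g1 g2 g3 : R -> R) :
  (forall t, is_derive t (1 : R) g (g1 t)) -> (forall t, is_derive t (1 : R) g1 (g2 t)) ->
  (forall t, is_derive t (1 : R) g2 (g3 t)) ->
  exists2 s, s \in `]0, 1[ & g 1 - g 0 = (g1 0 + g1 1) / 2 - g3 s / 12.
Proof.
move=> H H1 H2.
(* [K] is the error of the rule; it remains to find a point where it equals - [g3] / 12. *)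
pose K := g 1 - g 0 - (g1 0 + g1 1) / 2.
pose G t := g t - t / 2 * (g1 0 + g1 t) - K * t ^+ 3.
pose G1 t := g1 t - ((g1 0 + g1 t) / 2 + t / 2 * g2 t) - 3 * K * t ^+ 2.
pose G2 t := - (t / 2 * g3 t) - 6 * K * t.
have dG (u : R) : is_derive u (1 : R) G (G1 u).
  have h := H u; have h1 := H1 u.
  rewrite /G; apply: is_derive_eq.
  by rewrite /G1 /GRing.scale /=; field.
have dG1 (u : R) : is_derive u (1 : R) G1 (G2 u).
  have h1 := H1 u; have h2 := H2 u.
  rewrite /G1; apply: is_derive_eq.
  by rewrite /G2 /GRing.scale /=; field.
have cont (F F' : R -> R) (a b : R) : (forall t, is_derive t (1 : R) F (F' t)) ->
    {within `[a, b], continuous F}.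
  by move=> dF; apply: derivable_within_continuous => t _; case: (dF t).
have [s] := @MVT R _ _ 0 1 ltr01 (fun t _ => dG t) (cont _ _ _ _ dG).
rewrite in_itv /= => /andP[s0 s1].
have -> : G 1 - G 0 = 0 by rewrite /G /K; field.
rewrite subr0 mulr1 => G1s.
(* [G1] also vanishes at 0, so Rolle applies again on [0, s]. *)
have [u] := @MVT R _ _ 0 s s0 (fun t _ => dG1 t) (cont _ _ _ _ dG1).
rewrite in_itv /= => /andP[u0 us].
have -> : G1 s - G1 0 = 0 by rewrite -G1s /G1; field.
move/esym/eqP; rewrite subr0 mulf_eq0 (gt_eqF s0) orbF => /eqP G2u.
exists u; first by rewrite in_itv /= u0 (lt_trans us).
(* G2 u = -6 u (K + g3 u / 12), and u > 0. *)
have : u * (K + g3 u / 12) = 0.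
  by rewrite -[RHS](mulr0 (- 6^-1)) -G2u /G2; field.
move/eqP; rewrite mulf_eq0 (gt_eqF u0) /= => /eqP.
rewrite /K; lra.
Qed.

(** * Continuity of composite expressions *)

Section Continuity.
Variable R : realType.

Lemma continuous_sum (T : topologicalType) (W : normedModType R) (I : finType)
    (F : I -> T -> W) :
  (forall i, continuous (F i)) -> continuous (fun x => \sum_i F i x).
Proof. by move=> H; apply: continuous_big => //; exact: add_continuous. Qed.

Lemma continuous_mull (T : topologicalType) (c : R) (F : T -> R) :
  continuous F -> continuous (fun x => c * F x).
Proof. by move=> cF x; apply: cvgM; [exact: cvg_cst | exact: cF]. Qed.

Lemma continuous_scalel (T : topologicalType) (W : normedModType R)
    (F : T -> R) (w : W) : continuous F -> continuous (fun t => F t *: w).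
Proof.
by move=> cF t; apply: cvgZ; [exact: cF | exact: cvg_cst].
Qed.

Lemma continuous_add_fun (T : topologicalType) (W : normedModType R)
    (F G : T -> W) :
  continuous F -> continuous G -> continuous (fun t => F t + G t).
Proof. by move=> cF cG t; apply: cvgD; [exact: cF | exact: cG]. Qed.

Lemma continuous_scale_fun (T : topologicalType) (W : normedModType R)
    (F : T -> R) (G : T -> W) :
  continuous F -> continuous G -> continuous (fun t => F t *: G t).
Proof. by move=> cF cG t; apply: cvgZ; [exact: cF | exact: cG]. Qed.

Lemma continuous_mulfun (T : topologicalType) (F G : T -> R) :
  continuous F -> continuous G -> continuous (fun t => F t * G t).
Proof. by move=> cF cG t; apply: cvgM; [exact: cF | exact: cG]. Qed.

Lemma continuous_norm (T : topologicalType) (W : normedModType R)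
    (F : T -> W) : continuous F -> continuous (fun t => `|F t|).
Proof. by move=> cF t; apply: cvg_norm; exact: cF. Qed.

Lemma continuous_fst_comp (T U W : topologicalType) (F : T -> U * W) :
  continuous F -> continuous (fun t => (F t).1).
Proof.
move=> cF t; apply: (@continuous_comp _ _ _ F fst); first exact: cF.
exact: cvg_fst.
Qed.

Lemma continuous_snd_comp (T U W : topologicalType) (F : T -> U * W) :
  continuous F -> continuous (fun t => (F t).2).
Proof.
move=> cF t; apply: (@continuous_comp _ _ _ F snd); first exact: cF.
exact: cvg_snd.
Qed.

Lemma continuous_entry (T : topologicalType) n (F : T -> 'rV[R]_n) i :
  continuous F -> continuous (fun t => F t 0 i).
Proof.
move=> cF t; apply: (@continuous_comp _ _ _ F (fun M : 'rV[R]_n => M 0 i)).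
  exact: cF.
exact: coord_continuous.
Qed.

End Continuity.

Lemma dist_le_half (R : realFieldType) (e a b a' b' : R) :
  `|a - a'| < e / 2 -> `|b - b'| < e / 2 -> b' = a' -> `|a - b| <= e.
Proof.
move=> aa' bb' E; rewrite E distrC in bb'.
rewrite [e]splitr ltW // (le_lt_trans _ (ltrD aa' bb')) //.
by rewrite (le_trans _ (ler_normD _ _)) // addrA subrK.
Qed.

(** * Coordinates of the derivatives, and the directional derivatives of f *)

Section Coordinates.
Variables (R : realType) (n N : nat) (f : 'rV[R]_n -> 'rV[R]_N).
Hypothesis f_smooth : smooth f.
Implicit Types (x y h u v w : 'rV[R]_n) (s : seq 'I_n) (j : 'I_N).

Lemma iter_partial_cat s s' :
  iter_partial s (iter_partial s' f) = iter_partial (s ++ s') f.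
Proof. by rewrite /iter_partial foldr_cat. Qed.

Lemma smooth_iter_partial s : smooth (iter_partial s f).
Proof. by move=> s'; rewrite iter_partial_cat; exact: f_smooth. Qed.

Lemma D1_coord x v j :
  D1 f x v 0 j = \sum_(i < n) v 0 i * iter_partial [:: i] f x 0 j.
Proof. by rewrite summxE; apply: eq_bigr => i _; rewrite mxE. Qed.

Lemma D2_coord x v w j : D2 f x v w 0 j =
  \sum_(i < n) \sum_(k < n) v 0 i * w 0 k * iter_partial [:: i; k] f x 0 j.
Proof.
rewrite summxE; apply: eq_bigr => i _.
by rewrite summxE; apply: eq_bigr => k _; rewrite mxE.
Qed.

Lemma D3_coord x u v w j : D3 f x u v w 0 j =
  \sum_(i < n) \sum_(k < n) \sum_(l < n)
    u 0 i * v 0 k * w 0 l * iter_partial [:: i; k; l] f x 0 j.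
Proof.
rewrite summxE; apply: eq_bigr => i _.
rewrite summxE; apply: eq_bigr => k _.
by rewrite summxE; apply: eq_bigr => l _; rewrite mxE.
Qed.

Lemma continuous_coord s j : continuous (fun x => iter_partial s f x 0 j).
Proof.
move=> x; apply: (@continuous_comp _ _ _ (iter_partial s f) (fun M : 'rV[R]_N => M 0 j)).
  exact: (f_smooth s).1.
exact: coord_continuous.
Qed.

Lemma is_derive_basis s i x j :
  is_derive x (basis_vec R i) (fun y => iter_partial s f y 0 j)
    (iter_partial (i :: s) f x 0 j).
Proof.
have df := (f_smooth s).2 i x.
split; first by move/derivable_mxP : df; exact.
by rewrite /= derive_mx // mxE.
Qed.

(** Expand [v] in the standard basis and add one basis direction at a time; continuity of the
    partial derivatives is what [is_derive_add_dir] asks for. *)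
Lemma is_derive_f x v j : is_derive x v (fun y => f y 0 j) (D1 f x v 0 j).
Proof.
rewrite {1}[v]row_sum_delta D1_coord.
elim/big_rec2: _ => [|i l w _ H].
  apply/is_deriveP_cvg.
  under eq_fun do rewrite scaler0 add0r subrr scaler0.
  exact: cvg_cst.
apply: (is_derive_add_dir (D := fun y => v 0 i * iter_partial [:: i] f y 0 j)) H.
  by move=> y; apply: is_derive_scale_dir; exact: (is_derive_basis [::]).
exact/continuous_mull/continuous_coord.
Qed.

End Coordinates.

(** * Mean value formulas and symmetry of the second derivative *)

Section SmoothCalculus.
Variables (R : realType) (n N : nat) (f : 'rV[R]_n -> 'rV[R]_N).
Hypothesis f_smooth : smooth f.
Implicit Types (x y h u v w : 'rV[R]_n) (j : 'I_N).

Lemma is_derive_sum_coef (I : finType) x h (c : I -> R)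
    (F : I -> 'rV[R]_n -> R) (l : I -> R) :
  (forall i, is_derive x h (F i) (l i)) ->
  is_derive x h (fun y => \sum_i c i * F i y) (\sum_i c i * l i).
Proof.
move=> H.
have -> : (fun y => \sum_i c i * F i y) = \sum_i (c i \*: F i).
  by apply/funext => y; rewrite fct_sumE.
elim/big_rec2: _ => [|i a b _ H2]; first exact: is_derive_cst.
by apply: is_deriveD => //; exact: is_deriveZ.
Qed.

(** For fixed [v] this is a linear combination of first partials, which are again smooth. The head
    of the list in [iter_partial] is the outermost derivative, so the new direction [h] enters as
    the first argument. *)
Lemma is_derive_D1 x h v j :
  is_derive x h (fun y => D1 f y v 0 j) (D2 f x h v 0 j).
Proof.
under eq_fun do rewrite D1_coord.
have -> : D2 f x h v 0 j =
    \sum_i v 0 i * D1 (iter_partial [:: i] f) x h 0 j.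
  rewrite D2_coord exchange_big; apply: eq_bigr => i _ /=.
  rewrite D1_coord mulr_sumr; apply: eq_bigr => k _ /=; ring.
apply: is_derive_sum_coef => i.
exact/is_derive_f/smooth_iter_partial.
Qed.

Lemma is_derive_D2 x h v w j :
  is_derive x h (fun y => D2 f y v w 0 j) (D3 f x h v w 0 j).
Proof.
have -> : (fun y => D2 f y v w 0 j) = (fun y =>
    \sum_ik v 0 ik.1 * w 0 ik.2 * iter_partial [:: ik.1; ik.2] f y 0 j).
  by apply/funext => y; rewrite D2_coord pair_bigA.
have -> : D3 f x h v w 0 j =
    \sum_ik v 0 ik.1 * w 0 ik.2 * D1 (iter_partial [:: ik.1; ik.2] f) x h 0 j.
  rewrite D3_coord.
  under eq_bigr do rewrite pair_bigA /=.
  rewrite exchange_big; apply: eq_bigr => ik _ /=.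
  rewrite D1_coord mulr_sumr; apply: eq_bigr => k _ /=; ring.
apply: is_derive_sum_coef => ik.
exact/is_derive_f/smooth_iter_partial.
Qed.

(** The point on the segment depends on [j], because the mean value theorem holds only for each
    scalar component. *)
Lemma mean_value_f x h j :
  exists2 s : R, s \in `]0, 1[ & (f (x + h) - f x) 0 j = D1 f (x + s *: h) h 0 j.
Proof.
have [s s01 E] := mean_value_dir x (fun z => is_derive_f f_smooth z h j).
by exists s; rewrite // mxE [X in _ + X]mxE.
Qed.

Lemma mean_value_D1 x h v j : exists2 s : R, s \in `]0, 1[ &
  (D1 f (x + h) v - D1 f x v) 0 j = D2 f (x + s *: h) h v 0 j.
Proof.
have [s s01 E] := mean_value_dir x (fun z => is_derive_D1 z h v j).
by exists s; rewrite // mxE [X in _ + X]mxE.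
Qed.

(** The one-variable rule for t |-> f(x + t h), whose successive derivatives are D1, D2 and D3
    evaluated on copies of [h]. *)
Lemma trapezoid_f x h j : exists2 s : R, s \in `]0, 1[ &
  (f (x + h) - f x) 0 j = (D1 f x h 0 j + D1 f (x + h) h 0 j) / 2
     - D3 f (x + s *: h) h h h 0 j / 12.
Proof.
have [s s01 E] := @trapezoid_rule R _ _ _ _
  (fun t => (is_derive_line _ _ _ _ _).2 (is_derive_f f_smooth (x + t *: h) h j))
  (fun t => (is_derive_line _ _ _ _ _).2 (is_derive_D1 (x + t *: h) h h j))
  (fun t => (is_derive_line _ _ _ _ _).2 (is_derive_D2 (x + t *: h) h h h j)).
exists s; first exact: s01.
have e1 : x + 1 *: h = x + h by rewrite scale1r.
have e0 : x + 0 *: h = x by rewrite scale0r addr0.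
rewrite e1 e0 in E.
rewrite mxE [X in _ + X]mxE.
exact: E.
Qed.

Lemma continuous_D2 v w j : continuous (fun x => D2 f x v w 0 j).
Proof.
move=> x.
have -> : (fun y => D2 f y v w 0 j) = (fun y => \sum_(i < n) \sum_(k < n)
    v 0 i * w 0 k * iter_partial [:: i; k] f y 0 j).
  by apply/funext => y; rewrite D2_coord.
apply: continuous_sum => i; apply: continuous_sum => k.
exact/continuous_mull/continuous_coord.
Qed.

(** Two mean value steps: along [v] for y |-> f(y + w) - f(y), then along [w] for the resulting
    difference of first derivatives. *)
Lemma second_difference x v w j : exists s t : R,
  [/\ s \in `]0, 1[, t \in `]0, 1[ &
    (f (x + v + w) - f (x + v) - (f (x + w) - f x)) 0 j =
    D2 f (x + s *: v + t *: w) w v 0 j].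
Proof.
have H z : is_derive z v (fun y => f (y + w) 0 j - f y 0 j)
    (D1 f (z + w) v 0 j - D1 f z v 0 j).
  apply: is_deriveB; last exact: is_derive_f.
  have /is_deriveP_cvg := is_derive_f f_smooth (z + w) v j.
  by under eq_fun do rewrite addrA; move=> ?; apply/is_deriveP_cvg.
have [s s01 E] := mean_value_dir x H.
have [t t01 E2] := mean_value_D1 (x + s *: v) w v j.
by exists s, t; split=> //; rewrite -E2; move: E; rewrite !mxE.
Qed.

(** The second difference is symmetric in [v] and [w], so the two forms agree at suitable points
    arbitrarily close to [x]; continuity carries this to [x]. *)
Lemma D2_sym x v w : D2 f x v w = D2 f x w v.
Proof.
apply/rowP => j.
apply/eqP; rewrite -subr_eq0 -normr_le0; apply/ler_addgt0Pl => e e0.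
rewrite addr0.
have e2 : 0 < e / 2 by rewrite divr_gt0.
have /cvgrPdist_lt/(_ _ e2)/nbhs_ballP[d1 /= d10 H1] := @continuous_D2 v w j x.
have /cvgrPdist_lt/(_ _ e2)/nbhs_ballP[d2 /= d20 H2] := @continuous_D2 w v j x.
have vw1 : 0 < `|v| + `|w| + 1 by rewrite ltr_wpDl ?addr_ge0.
(* Shrinking [v] and [w] by [c] keeps all intermediate points where both continuity estimates hold;
   the factor c^2 is cancelled later. *)
have [c c0 cd] : exists2 c : R, 0 < c & c * (`|v| + `|w|) < Num.min d1 d2.
  have m0 : 0 < Num.min d1 d2 by rewrite lt_min d10.
  exists (Num.min d1 d2 / (`|v| + `|w| + 1)); first exact: divr_gt0.
  by rewrite mulrAC ltr_pdivrMr // ltr_pM2l // ltrDl.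
have close (s t : R) : s \in `]0, 1[ -> t \in `]0, 1[ ->
    ball x (Num.min d1 d2) (x + s *: (c *: v) + t *: (c *: w)).
  rewrite !in_itv /= => /andP[s0 s1] /andP[t0 t1].
  rewrite -ball_normE /= -addrA opprD addNKr normrN; apply: le_lt_trans cd.
  rewrite (le_trans (ler_normD _ _)) // !normrZ (gtr0_norm c0).
  rewrite (gtr0_norm s0) (gtr0_norm t0) mulrDr.
  by rewrite lerD // ler_piMl ?mulr_ge0 // ltW.
have D2Z z u u' : D2 f z (c *: u) (c *: u') 0 j = c ^+ 2 * D2 f z u u' 0 j.
  rewrite !D2_coord mulr_sumr; apply: eq_bigr => i _.
  rewrite mulr_sumr; apply: eq_bigr => k _; rewrite !mxE; ring.
have [p [q [Bp Bq Epq]]] : exists p q, [/\ ball x (Num.min d1 d2) p,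
    ball x (Num.min d1 d2) q & D2 f p w v 0 j = D2 f q v w 0 j].
  have [s [t [s01 t01 E]]] := second_difference x (c *: v) (c *: w) j.
  have [s' [t' [s'01 t'01 E']]] := second_difference x (c *: w) (c *: v) j.
  exists (x + s *: (c *: v) + t *: (c *: w)).
  exists (x + s' *: (c *: w) + t' *: (c *: v)).
  split; [exact: close | by rewrite addrAC; exact: close | ].
  apply: (mulfI (expf_neq0 2 (lt0r_neq0 c0))).
  apply: (etrans (esym (D2Z _ w v))); apply: (etrans (esym E)).
  apply: (etrans _ (D2Z _ v w)); apply: (etrans _ E').
  rewrite [x + c *: w + c *: v]addrAC; congr (fun_of_matrix _ 0 j).
  by rewrite !opprB addrACA [RHS]addrACA; congr (_ + _); exact: addrC.
have m1 : Num.min d1 d2 <= d1 by rewrite ge_min lexx.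
have m2 : Num.min d1 d2 <= d2 by rewrite ge_min lexx orbT.
have B1 := H1 _ (le_ball m1 Bq).
have B2 := H2 _ (le_ball m2 Bp).
exact: dist_le_half B1 B2 Epq.
Qed.


End SmoothCalculus.

(** * Multilinearity, and the compactness bound from the local condition *)

Section MultilinearForms.
Variables (R : realType) (n N : nat) (f : 'rV[R]_n -> 'rV[R]_N).
Implicit Types (x p q u v w e : 'rV[R]_n) (c : R) (j : 'I_N).

Lemma D1D x u v : D1 f x (u + v) = D1 f x u + D1 f x v.
Proof.
by rewrite -big_split; apply: eq_bigr => i _; rewrite mxE scalerDl.
Qed.

Lemma D1Z x c v : D1 f x (c *: v) = c *: D1 f x v.
Proof.
by rewrite scaler_sumr; apply: eq_bigr => i _; rewrite mxE scalerA.
Qed.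

Lemma D2Zl x c v w : D2 f x (c *: v) w = c *: D2 f x v w.
Proof.
rewrite scaler_sumr; apply: eq_bigr => i _.
by rewrite scaler_sumr; apply: eq_bigr => k _; rewrite mxE scalerA mulrA.
Qed.

Lemma D2Zr x c v w : D2 f x v (c *: w) = c *: D2 f x v w.
Proof.
rewrite scaler_sumr; apply: eq_bigr => i _.
by rewrite scaler_sumr; apply: eq_bigr => k _; rewrite mxE scalerA mulrCA.
Qed.

Lemma D3Z x c v : D3 f x (c *: v) (c *: v) (c *: v) = c ^+ 3 *: D3 f x v v v.
Proof.
rewrite scaler_sumr; apply: eq_bigr => i _.
rewrite scaler_sumr; apply: eq_bigr => k _.
rewrite scaler_sumr; apply: eq_bigr => l _; rewrite !mxE scalerA.
by congr (_ *: _); ring.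
Qed.

Lemma continuous_D1_arg (T : topologicalType) (V : T -> 'rV[R]_n) x :
  continuous V -> continuous (fun t => D1 f x (V t)).
Proof.
move=> cV; apply: continuous_sum => i.
exact/continuous_scalel/continuous_entry.
Qed.

Lemma continuous_D2_arg (T : topologicalType) (V W : T -> 'rV[R]_n) x :
  continuous V -> continuous W -> continuous (fun t => D2 f x (V t) (W t)).
Proof.
move=> cV cW; apply: continuous_sum => i; apply: continuous_sum => k.
by apply: continuous_scalel; apply: continuous_mulfun; exact: continuous_entry.
Qed.

Lemma continuous_D3_arg (T : topologicalType) (V : T -> 'rV[R]_n) x :
  continuous V -> continuous (fun t => D3 f x (V t) (V t) (V t)).
Proof.
move=> cV; apply: continuous_sum => i; apply: continuous_sum => k.
apply: continuous_sum => l; apply: continuous_scalel.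
apply: continuous_mulfun; last exact: continuous_entry.
by apply: continuous_mulfun; exact: continuous_entry.
Qed.

(** The left side of the local condition with (v_1, v_2, lambda) gathered into [z] and v_3 = [e]:
    linear in [z], though not in [e]. *)
Definition local_map x (z : ('rV[R]_n * 'rV[R]_n * R)) e : 'rV[R]_N :=
  D1 f x z.1.1 + D2 f x z.1.2 e + z.2 *: D3 f x e e e.

Lemma local_mapZ x c z e : local_map x (c *: z) e = c *: local_map x z e.
Proof. by rewrite /local_map /= D1Z D2Zl -scalerA -!scalerDr. Qed.

Lemma entry_add3 m (A B C : 'rV[R]_m) (l : R) (i : 'I_m) :
  (A + B + l *: C) 0 i = A 0 i + B 0 i + l * C 0 i.
Proof. by rewrite !mxE. Qed.

Lemma local_map_coord x z e j : local_map x z e 0 j =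
  D1 f x z.1.1 0 j + D2 f x z.1.2 e 0 j + z.2 * D3 f x e e e 0 j.
Proof. exact: entry_add3. Qed.

(** A closed subset of a product of closed unit balls, because the norm of a product is the maximum
    of the norms of its factors. *)
Lemma compact_spheres : compact [set z : ('rV[R]_n * 'rV[R]_n * R) * 'rV[R]_n |
  `|z.1| = 1 /\ `|z.2| = 1].
Proof.
have rV_ball : compact [set v : 'rV[R]_n | `|v| <= 1].
  apply: bounded_closed_compact.
    exists 1; split; first exact: real1.
    by move=> M M1 v /= /le_trans; apply; exact: ltW.
  have /continuous_closedP := @norm_continuous R 'rV[R]_n.
  by move=> /(_ [set y | y <= 1]) H; apply: H; exact: closed_le.
have R_ball : compact [set r : R | `|r| <= 1].
  have -> : [set r : R | `|r| <= 1] = `[-1, 1]%classic.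
    by apply/seteqP; split=> r /=; rewrite in_itv /= ler_norml.
  exact: segment_compact.
have cid : continuous (fun t : ('rV[R]_n * 'rV[R]_n * R) * 'rV[R]_n => t).
  by move=> t; exact: cvg_id.
apply: subclosed_compact
  (compact_setX (compact_setX (compact_setX rV_ball rV_ball) R_ball) rV_ball) _.
  apply: (@closedI _ [set z : _ * 'rV[R]_n | `|z.1| = 1]
                     [set z : _ * 'rV[R]_n | `|z.2| = 1]).
    have /continuous_closedP/(_ [set y | y = 1]) :
        continuous (fun z : ('rV[R]_n * 'rV[R]_n * R) * 'rV[R]_n => `|z.1|).
      by apply: continuous_norm; exact: continuous_fst_comp cid.
    by apply; exact: closed_eq.
  have /continuous_closedP/(_ [set y | y = 1]) :
      continuous (fun z : ('rV[R]_n * 'rV[R]_n * R) * 'rV[R]_n => `|z.2|).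
    by apply: continuous_norm; exact: continuous_snd_comp cid.
  by apply; exact: closed_eq.
move=> [[[p q] l] e] /= [].
rewrite !prod_normE /= => H ->; rewrite lexx.
have : Num.max (Num.max `|p| `|q|) `|l| <= 1 by rewrite H.
by rewrite !ge_max => /andP[/andP[-> ->] ->].
Qed.

(** The image [K] of the product of unit spheres is compact, hence closed, and the local condition
    keeps 0 out of it; so a ball around 0 misses [K], and its radius is the constant. *)
Lemma local_map_lower_bound a : local_condition f a -> exists2 c, 0 < c &
  forall z e, `|e| = 1 -> c * `|z| <= `|local_map a z e|.
Proof.
move=> loc.
pose F (t : ('rV[R]_n * 'rV[R]_n * R) * 'rV[R]_n) := local_map a t.1 t.2.
have cF : continuous F.
  have cid : continuous (fun t : ('rV[R]_n * 'rV[R]_n * R) * 'rV[R]_n => t).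
    by move=> t; exact: cvg_id.
  have c1 := continuous_fst_comp cid.
  have c2 := continuous_snd_comp cid.
  have c11 := continuous_fst_comp c1.
  exact: (continuous_add_fun
    (continuous_add_fun (continuous_D1_arg (continuous_fst_comp c11))
                        (continuous_D2_arg (continuous_snd_comp c11) c2))
    (continuous_scale_fun (continuous_snd_comp c1) (continuous_D3_arg c2))).
pose K := F @` [set z | `|z.1| = 1 /\ `|z.2| = 1].
have open_nK : open (~` K).
  apply: closed_openC; apply: compact_closed; first exact: norm_hausdorff.
  apply: continuous_compact compact_spheres.
  exact: continuous_subspaceT.
have nK0 : (~` K) 0.
  move=> [[[[p q] l] e] /= [z1 e1] Fz].
  have e0 : e != 0 by rewrite -normr_eq0 e1 oner_neq0.
  have [p0 q0 l0] := loc p q e l e0 Fz.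
  move: z1; rewrite p0 q0 l0 prod_normE /= prod_normE /= !normr0 !maxxx.
  by move/eqP; rewrite eq_sym oner_eq0.
have /nbhs_ballP[c /= c0 cP] := open_nbhs_nbhs (conj open_nK nK0).
exists c => // z e e1.
have [->|z0] := eqVneq z 0; first by rewrite normr0 mulr0.
have nz0 : 0 < `|z| by rewrite normr_gt0.
have : c <= `|local_map a (`|z|^-1 *: z) e|.
  rewrite leNgt; apply/negP => lt_c.
  have : ball 0 c (F (`|z|^-1 *: z, e)).
    by rewrite -ball_normE /= sub0r normrN.
  move/cP; apply; exists (`|z|^-1 *: z, e) => //=; split=> //.
  by rewrite normrZ normfV normr_id mulVf // gt_eqF.
(* Homogeneity in [z] carries the bound from the unit sphere to every [z]. *)
by rewrite local_mapZ normrZ normfV normr_id ler_pdivlMl // mulrC.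
Qed.

End MultilinearForms.

#[local] Opaque D1 D2 D3 iter_partial.

(** * Stability of the lower bound under moving the base points *)

Section Perturbation.
Variables (R : realType) (n N : nat) (f : 'rV[R]_n -> 'rV[R]_N).
Hypothesis f_smooth : smooth f.
Implicit Types (a x y p q u v w e : 'rV[R]_n) (j : 'I_N).

Lemma entry_le_norm m (v : 'rV[R]_m) (i : 'I_m) : `|v 0 i| <= `|v|.
Proof.
rewrite [leRHS]/Num.Def.normr /= mx_normrE.
exact: (le_bigmax _ (fun ij => `|v ij.1 ij.2|) (0, i)).
Qed.

Lemma norm_le_entries m (v : 'rV[R]_m) (r : R) :
  0 <= r -> (forall i, `|v 0 i| <= r) -> `|v| <= r.
Proof.
move=> r0 H; rewrite [leLHS]/Num.Def.normr /= mx_normrE.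
by apply: bigmax_le => // -[i k] _ /=; rewrite (ord1 i).
Qed.

Lemma iter_partial_near a (d : R) : 0 < d ->
  \forall x \near a, forall i k l : 'I_n,
    [/\ `|iter_partial [:: i] f x - iter_partial [:: i] f a| <= d,
        `|iter_partial [:: i; k] f x - iter_partial [:: i; k] f a| <= d &
        `|iter_partial [:: i; k; l] f x - iter_partial [:: i; k; l] f a| <= d].
Proof.
move=> d0.
have close s : \forall x \near a,
    `|iter_partial s f x - iter_partial s f a| <= d.
  have /cvgrPdist_le/(_ d d0) := (f_smooth s).1 a.
  by apply: filterS => x; rewrite distrC.
have FF : Filter (nbhs a) by exact: nbhs_filter.
apply: (@filter_forall _ _ _ _ FF) => i; apply: (@filter_forall _ _ _ _ FF) => k.
apply: (@filter_forall _ _ _ _ FF) => l.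
apply: (@filterS _ _ FF _ _ _
  (@filterI _ _ FF _ _ (close [:: i])
    (@filterI _ _ FF _ _ (close [:: i; k]) (close [:: i; k; l])))).
by move=> x [h1 [h2 h3]]; exact: And3 h1 h2 h3.
Qed.

Lemma sum_ord_bound m (F : 'I_m -> R) (b : R) :
  (forall i, `|F i| <= b) -> `|\sum_i F i| <= m%:R * b.
Proof.
move=> H; apply: (le_trans (ler_norm_sum _ _ _)).
apply: (@le_trans _ _ (\sum_(i < m) b)); first by apply: ler_sum => i _.
by rewrite sumr_const card_ord mulr_natl.
Qed.

(** Vectors carry the sup norm, so each of the n terms is at most |p| d. The next two lemmas repeat
    this with n^2 and n^3 terms. *)
Lemma D1_close x a p j (d : R) :
  (forall i, `|iter_partial [:: i] f x - iter_partial [:: i] f a| <= d) ->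
  `|D1 f x p 0 j - D1 f a p 0 j| <= n%:R * (`|p| * d).
Proof.
move=> H; rewrite {1}D1_coord D1_coord -sumrB; apply: sum_ord_bound => i.
rewrite -mulrBr normrM ler_pM ?entry_le_norm //.
by apply: le_trans (H i); apply: le_trans (entry_le_norm _ j); rewrite !mxE.
Qed.

Lemma D2_close x a q e j (d : R) :
  (forall i k, `|iter_partial [:: i; k] f x - iter_partial [:: i; k] f a| <= d) ->
  `|D2 f x q e 0 j - D2 f a q e 0 j| <= n%:R * (n%:R * (`|q| * `|e| * d)).
Proof.
move=> H; rewrite {1}D2_coord D2_coord -sumrB; apply: sum_ord_bound => i.
rewrite -sumrB; apply: sum_ord_bound => k.
rewrite -mulrBr normrM ler_pM //.
  by rewrite normrM ler_pM ?entry_le_norm.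
by apply: le_trans (H i k); apply: le_trans (entry_le_norm _ j); rewrite !mxE.
Qed.

Lemma D3_close x a e j (d : R) :
  (forall i k l,
    `|iter_partial [:: i; k; l] f x - iter_partial [:: i; k; l] f a| <= d) ->
  `|D3 f x e e e 0 j - D3 f a e e e 0 j| <=
    n%:R * (n%:R * (n%:R * (`|e| * `|e| * `|e| * d))).
Proof.
move=> H; rewrite {1}D3_coord D3_coord -sumrB; apply: sum_ord_bound => i.
rewrite -sumrB; apply: sum_ord_bound => k.
rewrite -sumrB; apply: sum_ord_bound => l.
rewrite -mulrBr normrM ler_pM //.
  by rewrite !normrM !ler_pM ?mulr_ge0 ?entry_le_norm.
by apply: le_trans (H i k l); apply: le_trans (entry_le_norm _ j); rewrite !mxE.
Qed.

(** Collects the three estimates: [d1], [d2], [d3] stand for the changes of the three forms, [k] for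
    n and [m] for the norm of the triple. *)
Lemma three_term_bound (d1 d2 d3 l m k d : R) :
  0 <= k -> 0 <= d -> 0 <= m -> `|l| <= m ->
  `|d1| <= k * (m * d) -> `|d2| <= k * (k * (m * d)) ->
  `|d3| <= k * (k * (k * d)) ->
  `|d1 + d2 + l * d3| <= (k + k ^+ 2 + k ^+ 3) * d * m.
Proof.
move=> k0 d0 m0 lm h1 h2 h3.
apply: (@le_trans _ _ (`|d1| + `|d2| + `|l| * `|d3|)).
  rewrite -normrM; apply: (le_trans (ler_normD _ _)).
  by rewrite lerD2r ler_normD.
have h4 : `|l| * `|d3| <= m * (k * (k * (k * d))) by exact: ler_pM.
apply: (le_trans (lerD (lerD h1 h2) h4)).
by rewrite le_eqVlt; apply/orP; left; apply/eqP; ring.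
Qed.

Lemma perturbation_identity (b1 b2 b3 a1 a2 a3 l : R) : a1 + a2 + l * a3 =
  (b1 + b2 + l * b3) - ((b1 - a1) + (b2 - a2) + l * (b3 - a3)).
Proof. ring. Qed.

(* The base points may depend on the component, as they do when they come from the scalar mean value theorem. *)
Definition stable_on (B : set 'rV[R]_n) (c : R) : Prop :=
  forall (X Y Z : 'I_N -> 'rV[R]_n) p q (l r : R) e,
    (forall j, [/\ B (X j), B (Y j) & B (Z j)]) -> `|e| = 1 -> 0 <= r ->
    (forall j, `|D1 f (X j) p 0 j + D2 f (Y j) q e 0 j
                 + l * D3 f (Z j) e e e 0 j| <= r) ->
    [/\ c * `|p| <= r, c * `|q| <= r & c * `|l| <= r].

(** Near [a] the base points change each component by at most half of the lower bound at [a], and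
    the other half survives. The sup norm lets the components be estimated separately. *)
Lemma local_condition_stable a : local_condition f a ->
  exists c d : R, [/\ 0 < c, 0 < d & stable_on (ball a d) c].
Proof.
move=> loc; have [c c0 cP] := local_map_lower_bound loc.
pose k : R := n%:R; pose K := k + k ^+ 2 + k ^+ 3.
have k0 : 0 <= k by exact: ler0n.
have K0 : 0 <= K by rewrite !addr_ge0 ?exprn_ge0.
(* Chosen so that K d0 <= c / 2; the added 1 keeps the denominator positive. *)
pose d0 := c / 2 / (K + 1).
have K1 : 0 < K + 1 by rewrite ltr_wpDl.
have d00 : 0 < d0 by rewrite !divr_gt0.
have /nbhs_ballP[d /= dpos dP] := iter_partial_near a d00.
exists (c / 2), d; split=> //; first exact: divr_gt0.
move=> X Y Z p q l r e ball_XYZ e1 r0 H.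
pose z := (p, q, l); pose m : R := `|z|.
have [pm qm lm] : [/\ `|p| <= m, `|q| <= m & `|l| <= m].
  have : m <= m by [].
  rewrite {1}/m /z !prod_normE /= !ge_max.
  by move=> /andP[/andP[]].
have m0 : 0 <= m by exact: normr_ge0.
have bound : `|local_map f a z e| <= r + K * d0 * m.
  apply: norm_le_entries => [|j]; first exact: addr_ge0 r0 (mulr_ge0 (mulr_ge0 K0 (ltW d00)) m0).
  have [BX BY BZ] := ball_XYZ j.
  have h1 := D1_close p j (fun i => let: And3 h _ _ := dP _ BX i i i in h).
  have h2 := D2_close q e j (fun i k => let: And3 _ h _ := dP _ BY i k k in h).
  have h3 := D3_close e j (fun i k l => let: And3 _ _ h := dP _ BZ i k l in h).
  rewrite e1 !mulr1 mul1r in h2 h3.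
  have hp : `|D1 f (X j) p 0 j - D1 f a p 0 j| <= k * (m * d0).
    by apply: (le_trans h1); rewrite ler_wpM2l // ler_wpM2r // ltW.
  have hq : `|D2 f (Y j) q e 0 j - D2 f a q e 0 j| <= k * (k * (m * d0)).
    by apply: (le_trans h2); rewrite !ler_wpM2l // ler_wpM2r // ltW.
  have h4 := three_term_bound k0 (ltW d00) m0 lm hp hq h3.
  rewrite (etrans (local_map_coord f a z e j) (perturbation_identity
    (D1 f (X j) p 0 j) (D2 f (Y j) q e 0 j) (D3 f (Z j) e e e 0 j) _ _ _ _)).
  by apply: (le_trans (ler_normB _ _)); exact: lerD (H j) h4.
have key : c / 2 * m <= r.
  have Kd : K * d0 <= c / 2.
    rewrite /d0 mulrA ler_pdivrMr // [K * _]mulrC ler_wpM2l ?lerDl //.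
    by rewrite ltW // divr_gt0.
  have := le_trans (cP z e e1) bound.
  have : K * d0 * m <= c / 2 * m by rewrite ler_wpM2r.
  rewrite -/m; lra.
have c20 : 0 <= c / 2 by rewrite ltW // divr_gt0.
by split; apply: le_trans key; rewrite ler_wpM2l.
Qed.

End Perturbation.

(** * Chords and tangents over a ball on which the stable bound holds *)

Section Chords.
Variables (R : realType) (n N : nat) (f : 'rV[R]_n -> 'rV[R]_N).
Variables (a : 'rV[R]_n) (c d : R).
Hypotheses (f_smooth : smooth f) (c_gt0 : 0 < c).
Hypothesis f_stable : stable_on f (ball a d) c.
Implicit Types (x y h u v w e : 'rV[R]_n) (j : 'I_N).

Lemma ball_segment x h (s : R) : ball a d x -> ball a d (x + h) ->
  s \in `]0, 1[ -> ball a d (x + s *: h).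
Proof.
rewrite -ball_normE /= in_itv /= => Bx Bh /andP[s0 s1].
(* Convexity of the ball, through a convex combination of the endpoints. *)
have -> : a - (x + s *: h) = (1 - s) *: (a - x) + s *: (a - (x + h)).
  by apply/rowP => i; rewrite !mxE; ring.
apply: (le_lt_trans (ler_normD _ _)).
rewrite !normrZ (gtr0_norm s0) gtr0_norm ?subr_gt0 //.
have -> : d = (1 - s) * d + s * d by ring.
by rewrite ltrD // ltr_pM2l // subr_gt0.
Qed.

Lemma mean_value_f_ball x y j : ball a d x -> ball a d y ->
  exists w, ball a d w /\ (f y - f x) 0 j = D1 f w (y - x) 0 j.
Proof.
move=> Bx By; have yE : x + (y - x) = y by rewrite addrC subrK.
have [s s01 E] := mean_value_f f_smooth x (y - x) j.
exists (x + s *: (y - x)); split; first by apply: ball_segment; rewrite ?yE.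
by rewrite yE in E.
Qed.

Lemma mean_value_D1_ball x y v j : ball a d x -> ball a d y ->
  exists w, ball a d w /\
    D1 f y v 0 j - D1 f x v 0 j = D2 f w v (y - x) 0 j.
Proof.
move=> Bx By; have yE : x + (y - x) = y by rewrite addrC subrK.
have [s s01 E] := mean_value_D1 f_smooth x (y - x) v j.
exists (x + s *: (y - x)); split; first by apply: ball_segment; rewrite ?yE.
(* Symmetry moves y - x to the second slot, where [stable_on] expects the unit direction. *)
by rewrite yE mxE [X in _ + X]mxE (D2_sym f_smooth) in E.
Qed.

Lemma trapezoid_f_ball x y j : ball a d x -> ball a d y ->
  exists w, ball a d w /\ f y 0 j - f x 0 j =
    (D1 f x (y - x) 0 j + D1 f y (y - x) 0 j) / 2
      - D3 f w (y - x) (y - x) (y - x) 0 j / 12.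
Proof.
move=> Bx By; have yE : x + (y - x) = y by rewrite addrC subrK.
have [s s01 E] := trapezoid_f f_smooth x (y - x) j.
exists (x + s *: (y - x)); split; first by apply: ball_segment; rewrite ?yE.
by rewrite yE mxE [X in _ + X]mxE in E.
Qed.

Lemma norm_normalize m (v : 'rV[R]_m) : v != 0 -> `|(`|v|^-1 *: v)| = 1.
Proof.
by move=> v0; rewrite normrZ normfV normr_id mulVf // normr_eq0.
Qed.

Lemma D2_0l x w : D2 f x 0 w = 0.
Proof. by rewrite -[X in D2 f x X](scale0r 0) D2Zl scale0r. Qed.

Lemma D1_0 x : D1 f x 0 = 0.
Proof. by rewrite -[X in D1 f x X](scale0r 0) D1Z scale0r. Qed.

(** Stability with the second and third order terms set to zero. It still asks for a unit vector
    [e], and normalizing [v] supplies one. *)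
Lemma stable_D1 (X : 'I_N -> 'rV[R]_n) v (r : R) :
  (forall j, ball a d (X j)) -> 0 <= r ->
  (forall j, `|D1 f (X j) v 0 j| <= r) -> c * `|v| <= r.
Proof.
move=> BX r0 H; have [->|v0] := eqVneq v 0; first by rewrite normr0 mulr0.
have BXXX j := And3 (BX j) (BX j) (BX j).
have [] := f_stable (l := 0) (q := 0) (p := v) BXXX (norm_normalize v0) r0 => //.
by move=> j; rewrite D2_0l mul0r mxE !addr0.
Qed.

Lemma chord_lower_bound x y : ball a d x -> ball a d y ->
  c * `|y - x| <= `|f y - f x|.
Proof.
move=> Bx By.
have [X XP] := choice (fun j => mean_value_f_ball j Bx By).
apply: (stable_D1 (X := X)) => // j; first exact: (XP j).1.
by rewrite -(XP j).2; exact: entry_le_norm.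
Qed.

Lemma immersion_on_ball x v : ball a d x -> D1 f x v = 0 -> v = 0.
Proof.
move=> Bx v0; apply/eqP; rewrite -normr_le0 -(pmulr_rle0 _ c_gt0).
apply: (stable_D1 (X := fun=> x)) => // j.
by rewrite v0 mxE normr0.
Qed.

Lemma D1_shift x u h (k : R) j :
  D1 f x (u + k *: h) 0 j = D1 f x u 0 j + k * D1 f x h 0 j.
Proof. by rewrite D1D D1Z mxE [X in _ + X]mxE. Qed.

Lemma D1_add x u v j : D1 f x (u + v) 0 j = D1 f x u 0 j + D1 f x v 0 j.
Proof. by rewrite D1D mxE. Qed.

(** One component of the reduction: [p1], [p2], [v1] are Df_x u, Df_y v, Df_x v; [h1], [h2] are Df_x
    h, Df_y h; [phi] is the chord; [s2], [s3] are the second and third order terms. Primes mark the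
    shift of u and v by mu h / 2. *)
Lemma chord_identity (p1 p2 v1 h1 h2 phi s2 s3 mu p1' v1' p2' : R) :
  p1' = p1 + mu / 2 * h1 -> v1' = v1 + mu / 2 * h1 ->
  p2' = p2 + mu / 2 * h2 -> phi = (h1 + h2) / 2 - s3 / 12 ->
  p2' - v1' = s2 -> p1 + p2 + mu * phi = 0 ->
  p1' + v1' + s2 + - (mu / 12) * s3 = 0.
Proof. by move=> -> -> -> -> <- E; rewrite -[RHS]E; field. Qed.

(* Adding mu/2 (y - x) to both tangent vectors absorbs the linear part of the chord through the trapezoid rule, leaving the form to which the local condition applies. *)
Lemma chord_tangent_independent x y u v (mu : R) :
  ball a d x -> ball a d y -> x != y ->
  D1 f x u + D1 f y v + mu *: (f y - f x) = 0 -> [/\ u = 0, v = 0 & mu = 0].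
Proof.
move=> Bx By xy E; set h := y - x.
have h0 : h != 0 by rewrite subr_eq0 eq_sym.
have m0 : `|h| != 0 by rewrite normr_eq0.
have [e e1 hE] : exists2 e, `|e| = 1 & `|h| *: e = h.
  exists (`|h|^-1 *: h); first exact: norm_normalize.
  by rewrite scalerA divff // scale1r.
pose u' := u + (mu / 2) *: h; pose v' := v + (mu / 2) *: h.
have [Y YP] := choice (fun j => mean_value_D1_ball v' j Bx By).
have [Z ZP] := choice (fun j => trapezoid_f_ball j Bx By).
have BXYZ j := And3 Bx (YP j).1 (ZP j).1.
(* With h = |h| e, the powers of |h| move into the unknowns |h| v' and - mu |h|^3 / 12, leaving the
   unit vector [e] as direction. *)
have key j : D1 f x (u' + v') 0 j + D2 f (Y j) (`|h| *: v') e 0 j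
    + (- (mu / 12) * `|h| ^+ 3) * D3 f (Z j) e e e 0 j = 0.
  have eD2 : D2 f (Y j) (`|h| *: v') e = D2 f (Y j) v' h.
    by rewrite D2Zl -D2Zr hE.
  have eD3 : `|h| ^+ 3 * D3 f (Z j) e e e 0 j = D3 f (Z j) h h h 0 j.
    by have := D3Z f (Z j) `|h| e; rewrite hE => ->; rewrite mxE.
  have Ej : D1 f x u 0 j + D1 f y v 0 j + mu * (f y 0 j - f x 0 j) = 0.
    have := congr1 (fun M : 'rV[R]_N => M 0 j) E.
    by rewrite /= entry_add3 [(0 : 'rV[R]_N) 0 j]mxE [(f y - f x) 0 j]mxE [(- f x) 0 j]mxE.
  rewrite eD2 -mulrA eD3 D1_add.
  exact: chord_identity (D1_shift x u h _ j) (D1_shift x v h _ j)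
    (D1_shift y v h _ j) (ZP j).2 (YP j).2 Ej.
have le0 j : `|D1 f x (u' + v') 0 j + D2 f (Y j) (`|h| *: v') e 0 j
    + (- (mu / 12) * `|h| ^+ 3) * D3 f (Z j) e e e 0 j| <= 0.
  by rewrite key normr0.
(* With r = 0 all three unknowns vanish; as |h| is nonzero, so do v', mu and then u, v. *)
have [] := f_stable (X := fun=> x) BXYZ e1 (lexx 0) le0.
rewrite !(pmulr_rle0 _ c_gt0) !normr_le0 scaler_eq0 (negPf m0) /=.
move=> /eqP uv0 /eqP v'0.
rewrite mulf_eq0 expf_eq0 /= (negPf m0) orbF oppr_eq0 mulf_eq0.
rewrite invr_eq0 pnatr_eq0 orbF => /eqP mu0.
have vv : v = 0 by move: v'0; rewrite /v' mu0 mul0r scale0r addr0.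
by move: uv0; rewrite /u' /v' vv mu0 mul0r scale0r !addr0.
Qed.

(** The chord bound gives injectivity and makes the inverse Lipschitz with constant 1 / c on the
    image. *)
Lemma embedding_on_ball : embedding_on f (ball a d).
Proof.
have f_inj x y : ball a d x -> ball a d y -> f x = f y -> x = y.
  move=> Bx By fxy; apply/eqP; rewrite -subr_eq0 -normr_le0.
  rewrite -(pmulr_rle0 _ c_gt0); apply: le_trans (chord_lower_bound By Bx) _.
  by rewrite fxy subrr normr0.
split; [exact: f_inj | by move=> x Bx v; exact: immersion_on_ball | ].
(* Phrased for every [z], so that choice yields a total inverse; off the image the condition is
   vacuous and 0 will do. *)
have inv z : exists x, forall x0, ball a d x0 -> f x0 = z -> x0 = x.
  have [[x [Bx fx]]|nx] := pselect (exists x, ball a d x /\ f x = z).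
    by exists x => x0 B0 f0; apply: f_inj => //; rewrite f0 fx.
  by exists 0 => x0 B0 f0; case: nx; exists x0.
have [g gP] := choice inv.
have gf x : ball a d x -> g (f x) = x by move=> Bx; rewrite -(gP (f x) x).
exists g; split=> //.
apply/subspace_continuousP => _ [x Bx <-].
apply/cvgrPdist_lt => eps eps0.
rewrite near_withinE; apply/nbhs_ballP.
exists (c * eps); first exact: mulr_gt0.
move=> z Bz [y By fy]; move: Bz; rewrite -fy -ball_normE /= => Bz.
rewrite /from_subspace !gf // -(ltr_pM2l c_gt0).
exact: le_lt_trans (chord_lower_bound By Bx) Bz.
Qed.

Lemma totally_skew_on_ball x y : ball a d x -> ball a d y -> f x <> f y ->
  totally_skew_at f x y.
Proof.
move=> Bx By fxy w1 w2 [w10 [v1 w1E]] [w20 [v2 w2E]].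
have xy : x != y by apply/eqP => xy; apply: fxy; rewrite xy.
split.
  (* Parallel directions give Df_x v1 - k Df_y v2 = 0, a relation with mu = 0, which forces w1 =
     0. *)
  move=> [k [k0 w12]].
  have [|v10 _ _] := @chord_tangent_independent x y v1 ((- k) *: v2) 0 Bx By xy.
    by rewrite D1Z -w1E -w2E scale0r addr0 w12 scaleNr subrr.
  by move/eqP: w10; apply; rewrite w1E v10 D1_0.
(* A common point gives - t w1 + s w2 + (f y - f x) = 0, a relation with mu = 1, hence 1 = 0. *)
move=> [z [[t _ tz] [s _ sz]]].
have [|_ _ /eqP] :=
    @chord_tangent_independent x y ((- t) *: v1) (s *: v2) 1 Bx By xy.
  rewrite !D1Z -w1E -w2E scale1r scaleNr.
  have -> : s *: w2 = f x + t *: w1 - f y by rewrite tz -sz addrC addKr.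
  by apply/rowP => i; rewrite !mxE; ring.
by rewrite oner_eq0.
Qed.

End Chords.
Theorem theorem2p1 (R : realType) (n N : nat) (f : 'rV[R]_n -> 'rV[R]_N)
  (a : 'rV[R]_n) :
  (0 < n)%N -> smooth f -> local_condition f a ->
  exists U : set 'rV[R]_n, [/\ open U, U a & totally_skew_embedding f U].
Proof.
move=> _ f_smooth loc.
have [c [d [c0 d0 st]]] := local_condition_stable f_smooth loc.
exists (ball a d); split.
- exact: ball_open.
- exact: ballxx.
split; first exact: embedding_on_ball f_smooth c0 st.
by move=> x y Bx By; exact: (totally_skew_on_ball f_smooth c0 st Bx By).
Qed.
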